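(* Let $C$ be a compact Hausdorff topological group with identity $e$ and let $D<C$ be a dense subgroup. Let $\{U_i\}_{i\in I}$ be a family of open subsets of $C$ such that (1) $\{U_i\}_{i\in I}$ is a basis of the topology at the identity $e$ of $C$, closed under finite intersections; (2) for every $i\in I$ there is $j\in I$ such that $\overline{U_j}^2\subseteq U_i$, and $U_i=U_i^{-1}$; (3) $x^{-1}U_ix=U_i$ for all $i\in I$, $x\in C$. Suppose $D$ is equipped with a first-order structure $\mathcal{D}=(D,\cdot,\dots)$ in such a way that for some $A\subseteq D$, the set $U_i'=U_i\cap D$ is $A$-definable in $\mathcal{D}$ for each $i\in I$. Then for every monster model $\mathcal{D}^*$ of $\mathcal{D}$ there exists a surjective homomorphism $\mathrm{st}\colon\mathcal{D}^*\to C$ such that (a) $\ker(\mathrm{st})=\bigcap_{i\in I}{U_i'}^*$ is an $A$-type-definable normal subgroup of $\mathcal{D}^*$ of bounded index; (b) $\mathrm{st}(d)=d$ for $d\in D$, and for every definable subset $S$ of $D$, if $S^*$ is the interpretation of $S$ in $\mathcal{D}^*$, then $\mathrm{st}(S^* )=\overline{S}$ (closure taken in $C$); (c) $\mathrm{st}$ induces an isomorphism of groups $\widetilde{\mathrm{st}}\colon\mathcal{D}^*/\ker(\mathrm{st})\to C$ which is a homeomorphism, where $\mathcal{D}^*/\ker(\mathrm{st})$ is endowed with the logic topology.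
   Context: A monster model $\mathcal{D}^*$ is a $\kappa$-saturated and $\kappa$-strongly homogeneous elementary extension of $\mathcal{D}$ for a sufficiently big cardinal $\kappa$; small means of cardinality $<\kappa$, and bounded index means index $<\kappa$. $A$-type-definable means defined by a conjunction of a family of formulas with parameters in $A$. For a definable set $X$ in $\mathcal{D}$, $X^*$ denotes its interpretation in $\mathcal{D}^*$ (the set defined by the same formula). For a normal bounded-index type-definable subgroup $N$ of $\mathcal{D}^*$, the logic topology on $\mathcal{D}^*/N$ is the topology in which a set is closed iff its preimage in $\mathcal{D}^*$ is type-definable over a small set of parameters. *)

(* Defs.v *)
From HB Require Import structures.
From mathcomp Require Import all_boot.
From mathcomp Require Import boolp classical_sets functions cardinality.
From mathcomp Require Import topology.

Set Implicit Arguments.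
Unset Strict Implicit.
Unset Printing Implicit Defensive.

Import Algebra.

Local Open Scope classical_set_scope.
Local Open Scope card_scope.
Local Open Scope group_scope.

HB.mixin Record isTopologicalGroup G of Group G & Topological G := {
  mulg_continuous : continuous (fun xy : (G * G)%type => xy.1 * xy.2);
  invg_continuous : continuous (fun x : G => x^-1)
}.

#[short(type="topologicalGroupType")]
HB.structure Definition TopologicalGroup :=
  {G of Group G & Topological G & isTopologicalGroup G}.

Definition basis_at (T : topologicalType) (x : T) (I : Type) (U : I -> set T) :=
  (forall i, open (U i) /\ U i x) /\
  (forall V : set T, nbhs x V -> exists i, U i `<=` V).

Record subgroup (G : groupType) (N : set G) : Prop := {
  subgroup1 : N 1;
  subgroupM : forall x y, N x -> N y -> N (x * y);
  subgroupV : forall x, N x -> N x^-1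
}.

Definition normal_subgroup (G : groupType) (N : set G) : Prop :=
  subgroup N /\ forall g x, N x -> N (g^-1 * x * g).

Record normalSubgroup (G : groupType) := NormalSubgroup {
  ns_set :> set G;
  ns_normal : normal_subgroup ns_set
}.

Definition lcoset_set (G : groupType) (N : set G) (x : G) : set G :=
  [set x * n | n in N].

Definition quotient (G : groupType) (N : normalSubgroup G) : Type :=
  {X : set G | exists x, X = lcoset_set N x}.

Definition coset (G : groupType) (N : normalSubgroup G) (x : G) : quotient N :=
  exist _ (lcoset_set N x) (ex_intro _ x erefl).

Section Quotient.
Variables (G : groupType) (N : normalSubgroup G).

HB.instance Definition _ := gen_eqMixin (quotient N).
HB.instance Definition _ := gen_choiceMixin (quotient N).

Lemma quotient_inj (X Y : quotient N) : sval X = sval Y -> X = Y.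
Proof.
case: X Y => [X pX] [Y pY] /= XY; subst Y.
by congr exist; exact: Prop_irrelevance.
Qed.

Lemma coset_surj (X : quotient N) : exists x, X = coset N x.
Proof. by case: X => X [x XE]; exists x; apply: quotient_inj. Qed.

Lemma lcoset_setM (x y : G) :
  [set a * b | a in lcoset_set N x & b in lcoset_set N y] =
  lcoset_set N (x * y).
Proof.
have [[N1 NM NV] NJ] := ns_normal N.
apply/seteqP; split => [_ [_ [n Nn <-]] [_ [m Nm <-] <-]|_ [n Nn <-]].
  exists ((y^-1 * n * y) * m); first by apply: NM => //; exact: NJ.
  by rewrite !mulgA mulgK.
by exists x; [exists 1; rewrite ?mulg1|exists (y * n); [exists n|rewrite mulgA]].
Qed.

Lemma lcoset_setV (x : G) :
  [set a^-1 | a in lcoset_set N x] = lcoset_set N x^-1.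
Proof.
have [[N1 NM NV] NJ] := ns_normal N.
apply/seteqP; split => [_ [_ [n Nn <-] <-]|_ [n Nn <-]].
  exists (x * n^-1 * x^-1); last by rewrite !mulgA mulVg mul1g invgM.
  by rewrite -[X in X * n^-1]invgK; apply: NJ; exact: NV.
exists (n^-1 * x); last by rewrite invgM invgK.
exists (x^-1 * n^-1 * x); first by apply: NJ; exact: NV.
by rewrite !mulgA mulgV mul1g.
Qed.

Lemma quotient_mul_subproof (X Y : quotient N) : exists x,
  [set a * b | a in sval X & b in sval Y] = lcoset_set N x.
Proof.
have [x ->] := coset_surj X; have [y ->] := coset_surj Y.
by exists (x * y); exact: lcoset_setM.
Qed.

Definition quotient_mul (X Y : quotient N) : quotient N :=
  exist _ _ (quotient_mul_subproof X Y).

Lemma quotient_inv_subproof (X : quotient N) : exists x,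
  [set a^-1 | a in sval X] = lcoset_set N x.
Proof. by have [x ->] := coset_surj X; exists x^-1; exact: lcoset_setV. Qed.

Definition quotient_inv (X : quotient N) : quotient N :=
  exist _ _ (quotient_inv_subproof X).

Lemma quotient_mulE x y :
  quotient_mul (coset N x) (coset N y) = coset N (x * y).
Proof. by apply: quotient_inj; exact: lcoset_setM. Qed.

Lemma quotient_invE x : quotient_inv (coset N x) = coset N x^-1.
Proof. by apply: quotient_inj; exact: lcoset_setV. Qed.

Lemma quotient_mulA : associative quotient_mul.
Proof.
move=> X Y Z; have [x ->] := coset_surj X; have [y ->] := coset_surj Y.
by have [z ->] := coset_surj Z; rewrite !quotient_mulE mulgA.
Qed.

Lemma quotient_mul1 : left_id (coset N 1) quotient_mul.
Proof. by move=> X; have [x ->] := coset_surj X; rewrite quotient_mulE mul1g. Qed.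

Lemma quotient_mulr1 : right_id (coset N 1) quotient_mul.
Proof. by move=> X; have [x ->] := coset_surj X; rewrite quotient_mulE mulg1. Qed.

Lemma quotient_mulV : left_inverse (coset N 1) quotient_inv quotient_mul.
Proof.
move=> X; have [x ->] := coset_surj X.
by rewrite quotient_invE quotient_mulE mulVg.
Qed.

Lemma quotient_mulrV : right_inverse (coset N 1) quotient_inv quotient_mul.
Proof.
move=> X; have [x ->] := coset_surj X.
by rewrite quotient_invE quotient_mulE mulgV.
Qed.

HB.instance Definition _ := isGroup.Build (quotient N)
  quotient_mulA quotient_mul1 quotient_mulr1 quotient_mulV quotient_mulrV.

End Quotient.

Definition kernel (G H : groupType) (f : {multiplicative G -> H}) : set G :=
  [set x | f x = 1].

Lemma kernel_normal (G H : groupType) (f : {multiplicative G -> H}) :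
  normal_subgroup (kernel f).
Proof.
have f1 : f 1 = 1 by apply: (mulgI (f 1)); rewrite -gmulfM !mulg1.
have fV x : f x^-1 = (f x)^-1.
  by apply: (mulgI (f x)); rewrite -gmulfM !mulgV f1.
split; first split=> [//|x y /= fx fy|x /= fx].
- by rewrite /kernel /= gmulfM fx fy mulg1.
- by rewrite /kernel /= fV fx invg1.
- by move=> g x /= fx; rewrite /kernel /= !gmulfM fV fx mulg1 mulVg.
Qed.

Definition ker (G H : groupType) (f : {multiplicative G -> H}) :
  normalSubgroup G := NormalSubgroup (kernel_normal f).

(* Symbols are sorted by arity: [funsym L k] is the type of k-ary ones. *)
Record language := Language {
  funsym : nat -> Type;
  relsym : nat -> Type
}.

(* Well-scoped de Bruijn syntax: the free variables of a [term L n] or of a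
   [formula L n] are indexed by ['I_n]; [All] binds variable 0. *)
Inductive term (L : language) (n : nat) : Type :=
| Var of 'I_n
| App k of funsym L k & ('I_k -> term L n).

Inductive formula (L : language) : nat -> Type :=
| Bot n : formula L n
| Eq n : term L n -> term L n -> formula L n
| Rel n k : relsym L k -> ('I_k -> term L n) -> formula L n
| Imp n : formula L n -> formula L n -> formula L n
| All n : formula L n.+1 -> formula L n.

Record structure (L : language) (T : Type) := Structure {
  finterp : forall k, funsym L k -> ('I_k -> T) -> T;
  rinterp : forall k, relsym L k -> ('I_k -> T) -> Prop
}.

Definition vcons (T : Type) n (x : T) (v : 'I_n -> T) : 'I_n.+1 -> T :=
  fun i => if unlift ord0 i is Some j then v j else x.

Fixpoint eval L T (M : structure L T) n (v : 'I_n -> T) (t : term L n) : T :=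
  match t with
  | Var i => v i
  | App k f ts => finterp M f (fun i => eval M v (ts i))
  end.

Fixpoint sat L T (M : structure L T) n (phi : formula L n) :
    ('I_n -> T) -> Prop :=
  match phi in formula _ n return ('I_n -> T) -> Prop with
  | Bot _ => fun=> False
  | Eq _ t u => fun v => eval M v t = eval M v u
  | Rel _ _ r ts => fun v => rinterp M r (fun i => eval M v (ts i))
  | Imp _ p q => fun v => sat M p v -> sat M q v
  | All _ p => fun v => forall x, sat M p (vcons x v)
  end.

Lemma sat_Imp L T (M : structure L T) n (p q : formula L n) v :
  sat M (Imp p q) v = (sat M p v -> sat M q v).
Proof. by []. Qed.

Lemma sat_All L T (M : structure L T) n (p : formula L n.+1) v :
  sat M (All p) v = forall x, sat M p (vcons x v).
Proof. by []. Qed.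

(* Formulas phi(x, a) in one variable x (variable 0) with parameters a in T. *)
Record pformula (L : language) (T : Type) := PFormula {
  pf_arity : nat;
  pf_form : formula L pf_arity.+1;
  pf_param : 'I_pf_arity -> T
}.

Arguments pf_param {L T} p _.

Definition over L T (A : set T) (p : pformula L T) : Prop :=
  forall i, A (pf_param p i).

Definition pf_map L T T' (f : T -> T') (p : pformula L T) : pformula L T' :=
  PFormula (pf_form p) (f \o pf_param p).

Definition pf_set L T (M : structure L T) (p : pformula L T) : set T :=
  [set x | sat M (pf_form p) (vcons x (pf_param p))].

Definition definable_over L T (M : structure L T) (A S : set T) : Prop :=
  exists2 p : pformula L T, over A p & S = pf_set M p.

Definition definable L T (M : structure L T) (S : set T) : Prop :=
  definable_over M setT S.

Definition type_definable_over L T (M : structure L T) (A S : set T) : Prop :=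
  exists2 P : set (pformula L T), P `<=` over A &
    S = \bigcap_(p in P) pf_set M p.

Definition elementary L T T' (M : structure L T) (M' : structure L T')
    (j : T -> T') : Prop :=
  forall n (phi : formula L n) (v : 'I_n -> T),
    sat M phi v <-> sat M' phi (j \o v).

(* The interpretation S^* of a definable set S; see [starE]. *)
Definition star L T T' (M : structure L T) (M' : structure L T')
    (j : T -> T') (S : set T) : set T' :=
  [set y | exists2 p : pformula L T, S = pf_set M p &
                                     pf_set M' (pf_map j p) y].

(* The cardinal K is represented by a type: |A| < |K|. *)
Definition card_lt (K T : Type) (A : set T) : Prop :=
  A #<= [set: K] /\ ~ ([set: K] #<= A).

Definition saturated (K : Type) L T (M : structure L T) : Prop :=
  forall (A : set T) (P : set (pformula L T)),
    card_lt K A -> P `<=` over A ->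
    (forall Q : set (pformula L T), finite_set Q -> Q `<=` P ->
       \bigcap_(p in Q) pf_set M p !=set0) ->
    \bigcap_(p in P) pf_set M p !=set0.

Record automorphism L T (M : structure L T) (g : T -> T) : Prop := {
  auto_bij : bijective g;
  auto_fun : forall k (f : funsym L k) v,
    g (finterp M f v) = finterp M f (g \o v);
  auto_rel : forall k (r : relsym L k) v,
    rinterp M r v <-> rinterp M r (g \o v)
}.

Definition partial_elementary L T (M : structure L T) (A : set T)
    (f : T -> T) : Prop :=
  forall n (phi : formula L n) (v : 'I_n -> T), (forall i, A (v i)) ->
    (sat M phi v <-> sat M phi (f \o v)).

Definition strongly_homogeneous (K : Type) L T (M : structure L T) : Prop :=
  forall (A : set T) (f : T -> T),
    card_lt K A -> partial_elementary M A f ->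
    exists2 g, automorphism M g & {in A, g =1 f}.

(* "Sufficiently big" is made precise as 2 ^ (|L| + |T| + aleph_0) < K, the
   exponent being the number of formulas with parameters in T. *)
Record monster_model (K : Type) L T (M : structure L T)
    T' (M' : structure L T') (j : T -> T') : Prop := {
  monster_big : card_lt K [set: set (pformula L T)];
  monster_elementary : elementary M M' j;
  monster_saturated : saturated K M';
  monster_homogeneous : strongly_homogeneous K M'
}.

Definition is_group T (op : T -> T -> T) : Prop :=
  associative op /\
  exists2 e, left_id e op & forall x, exists y, op y x = e.

Definition group_of T (op : T -> T -> T) (h : is_group op) : Type := T.

Section GroupOf.
Variables (T : Type) (op : T -> T -> T) (h : is_group op).

HB.instance Definition _ := gen_eqMixin (group_of h).
HB.instance Definition _ := gen_choiceMixin (group_of h).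

Definition group_of_one : group_of h := s2val (cid2 h.2).

Lemma group_of_mul1 : left_id group_of_one op.
Proof. exact: s2valP (cid2 h.2). Qed.

Definition group_of_inv (x : group_of h) : group_of h :=
  sval (cid (s2valP' (cid2 h.2) x)).

Lemma group_of_mulV : left_inverse group_of_one group_of_inv op.
Proof. by move=> x; exact: svalP (cid (s2valP' (cid2 h.2) x)). Qed.

Lemma group_of_mulrV : right_inverse group_of_one group_of_inv op.
Proof.
move=> x; rewrite -[LHS]group_of_mul1.
rewrite -{1}(group_of_mulV (group_of_inv x)) -h.1.
by rewrite [op (group_of_inv x) _]h.1 group_of_mulV group_of_mul1 group_of_mulV.
Qed.

Lemma group_of_mulr1 : right_id group_of_one op.
Proof. by move=> x; rewrite -(group_of_mulV x) h.1 group_of_mulrV group_of_mul1. Qed.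

HB.instance Definition _ := isGroup.Build (group_of h)
  h.1 group_of_mul1 group_of_mulr1 group_of_mulV group_of_mulrV.

End GroupOf.

Definition pair_fun (T : Type) (x y : T) : 'I_2 -> T :=
  fun i => if i == ord0 then x else y.

Definition binop L T (M : structure L T) (m : funsym L 2) (x y : T) : T :=
  finterp M m (pair_fun x y).

Lemma subgroup_is_group L (C : groupType) (D : set C) (M : structure L D)
    (m : funsym L 2) :
  subgroup D ->
  (forall x y : D, set_val (binop M m x y) = set_val x * set_val y) ->
  is_group (binop M m).
Proof.
move=> [D1 _ DV] hM.
have vinj : injective (set_val : D -> C) by move=> x y; exact: val_inj.
split=> [x y z|]; first by apply: vinj; rewrite !hM mulgA.
have D1' : 1 \in D by rewrite inE.
exists (exist _ 1 D1' : D) => x; first by apply: vinj; rewrite hM mul1g.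
have DV' : (set_val x)^-1 \in D.
  by rewrite inE; apply: DV; apply: set_mem; exact: valP.
by exists (exist (fun z => z \in D) _ DV' : D); apply: vinj; rewrite hM mulVg.
Qed.

Section GroupSentences.
Variables (L : language) (m : funsym L 2).

Let mulT n (t u : term L n) : term L n := App m (pair_fun t u).
Let Ex n (p : formula L n.+1) : formula L n := Imp (All (Imp p (Bot L _))) (Bot L _).
Let And n (p q : formula L n) : formula L n := Imp (Imp p (Imp q (Bot L _))) (Bot L _).
Let V0 n : term L n.+1 := Var L ord0.
Let V1 n : term L n.+2 := Var L (lift ord0 ord0).
Let V2 n : term L n.+3 := Var L (lift ord0 (lift ord0 ord0)).

Let assoc_sentence : formula L 0 := All (All (All
  (Eq (mulT (V2 _) (mulT (V1 _) (V0 _))) (mulT (mulT (V2 _) (V1 _)) (V0 _))))).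

Let unit_inv_sentence : formula L 0 := Ex (And
  (All (Eq (mulT (V1 _) (V0 _)) (V0 _)))
  (All (Ex (Eq (mulT (V0 _) (V1 _)) (V2 _))))).

Lemma vcons0 T n x (v : 'I_n -> T) : vcons x v ord0 = x.
Proof. by rewrite /vcons unlift_none. Qed.

Lemma vconsS T n x (v : 'I_n -> T) i : vcons x v (lift ord0 i) = v i.
Proof. by rewrite /vcons liftK. Qed.

Let eval_mulT T (M : structure L T) n (v : 'I_n -> T) t u :
  eval M v (mulT t u) = binop M m (eval M v t) (eval M v u).
Proof.
by rewrite /= /binop; congr finterp; apply/funext => i; rewrite /pair_fun; case: ifP.
Qed.

Let sat_Ex T (M : structure L T) n (p : formula L n.+1) v :
  sat M (Ex p) v <-> exists x, sat M p (vcons x v).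
Proof.
split=> [/= h|[x px] /= h]; last exact: (h x).
by apply: contrapT => h'; apply: h => x px; apply: h'; exists x.
Qed.

Let sat_And T (M : structure L T) n (p q : formula L n) v :
  sat M (And p q) v <-> sat M p v /\ sat M q v.
Proof.
split=> [/= h|[hp hq] /= h]; last exact: h.
by apply: contrapT => h'; apply: h => hp hq; apply: h'.
Qed.

Let is_group_sat T (M : structure L T) (v : 'I_0 -> T) :
  is_group (binop M m) <-> sat M assoc_sentence v /\ sat M unit_inv_sentence v.
Proof.
split=> [[hA [e he hV]]|[hA /sat_Ex[e /sat_And[he hV]]]].
  split; first by move=> x y z; rewrite /sat !eval_mulT /= !(vcons0, vconsS).
  apply/sat_Ex; exists e; apply/sat_And; split=> x.
    by rewrite /sat eval_mulT /= !(vcons0, vconsS).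
  have [y yx] := hV x; move=> /(_ y); apply.
  by rewrite /sat eval_mulT /= !(vcons0, vconsS).
split=> [x y z|].
  by have := hA x y z; rewrite /sat !eval_mulT /= !(vcons0, vconsS).
exists e => x; first by have := he x; rewrite /sat !eval_mulT /= !(vcons0, vconsS).
apply: contrapT => h; apply: (hV x) => y yx; apply: h; exists y.
by move: yx; rewrite /sat !eval_mulT /= !(vcons0, vconsS).
Qed.

Lemma elementary_is_group T T' (M : structure L T) (M' : structure L T')
    (j : T -> T') :
  elementary M M' j -> is_group (binop M m) -> is_group (binop M' m).
Proof.
move=> hj hM; have v : 'I_0 -> T by case.
have [h1 h2] := (is_group_sat M v).1 hM.
by apply/(is_group_sat M' (j \o v)); split; exact/hj.
Qed.

End GroupSentences.

Lemma vcons_comp T T' (f : T -> T') n x (v : 'I_n -> T) :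
  f \o vcons x v = vcons (f x) (f \o v).
Proof. by apply/funext => i /=; rewrite /vcons; case: unlift. Qed.

Section Star.
Variables (L : language) (T T' : Type).
Variables (M : structure L T) (M' : structure L T') (j : T -> T').

Definition upren n k (f : 'I_n -> 'I_k) : 'I_n.+1 -> 'I_k.+1 :=
  vcons ord0 (lift ord0 \o f).

Fixpoint tren n k (f : 'I_n -> 'I_k) (t : term L n) : term L k :=
  match t with
  | Var i => Var L (f i)
  | App _ g ts => App g (fun i => tren f (ts i))
  end.

Fixpoint fren n (phi : formula L n) : forall k, ('I_n -> 'I_k) -> formula L k :=
  match phi in formula _ n return forall k, ('I_n -> 'I_k) -> formula L k with
  | Bot _ => fun k _ => Bot L k
  | Eq _ t u => fun k f => Eq (tren f t) (tren f u)
  | Rel _ _ r ts => fun k f => Rel r (fun i => tren f (ts i))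
  | Imp _ p q => fun k f => Imp (fren p f) (fren q f)
  | All _ p => fun k f => All (fren p (upren f))
  end.

Lemma eval_tren S (N : structure L S) n k (f : 'I_n -> 'I_k) v t :
  eval N v (tren f t) = eval N (v \o f) t.
Proof. by elim: t => //= l g ts IH; congr finterp; apply/funext => i; exact: IH. Qed.

Lemma vcons_upren S n k (f : 'I_n -> 'I_k) x (v : 'I_k -> S) :
  vcons x v \o upren f = vcons x (v \o f).
Proof. by rewrite vcons_comp vcons0; congr vcons; apply/funext => i /=; rewrite vconsS. Qed.

Lemma sat_fren S (N : structure L S) n (phi : formula L n) k
    (f : 'I_n -> 'I_k) v : sat N (fren phi f) v <-> sat N phi (v \o f).
Proof.
elim: phi k f v => {n} [n|n t u|n l r ts|n p IHp q IHq|n p IHp] k f v //=.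
- by rewrite !eval_tren.
- suff -> : (fun i => eval N v (tren f (ts i))) =
            (fun i => eval N (v \o f) (ts i)) by [].
  by apply/funext => i; exact: eval_tren.
- by split=> h /IHp/h/IHq.
- by split=> h x; have := h x; rewrite IHp vcons_upren.
Qed.

Lemma star_sub (p q : pformula L T) : elementary M M' j ->
  pf_set M p `<=` pf_set M q ->
  pf_set M' (pf_map j p) `<=` pf_set M' (pf_map j q).
Proof.
move=> hj pq y.
pose v (i : 'I_(pf_arity p + pf_arity q)) := match fintype.split i with
  | inl a => pf_param p a | inr b => pf_param q b end.
pose fp := @lshift (pf_arity p) (pf_arity q).
pose fq := @rshift (pf_arity p) (pf_arity q).
have vp : v \o fp = pf_param p.
  by apply/funext => i; rewrite /v /= -[fp i]/(unsplit (inl i)) unsplitK.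
have vq : v \o fq = pf_param q.
  by apply/funext => i; rewrite /v /= -[fq i]/(unsplit (inr i)) unsplitK.
pose phi := Imp (fren (pf_form p) (upren fp)) (fren (pf_form q) (upren fq)).
have hphi : sat M (All phi) v.
  rewrite sat_All => x; rewrite sat_Imp.
  rewrite (propext (sat_fren _ _ _ _)) vcons_upren vp.
  rewrite (propext (sat_fren _ (pf_form q) _ _)) vcons_upren vq.
  exact: pq.
have := (hj _ _ _).1 hphi; rewrite sat_All => /(_ y).
rewrite sat_Imp (propext (sat_fren _ _ _ _)) vcons_upren -compA vp.
rewrite (propext (sat_fren _ (pf_form q) _ _)) vcons_upren -compA vq.
exact.
Qed.

Lemma starE (p : pformula L T) : elementary M M' j ->
  star M M' j (pf_set M p) = pf_set M' (pf_map j p).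
Proof.
move=> hj; apply/seteqP; split=> [y [q pq]|y py]; last by exists p.
by apply: star_sub => //; rewrite pq.
Qed.

End Star.

(* [D^*]: the carrier of an elementary extension of a structure expanding the
   group D, with the interpretation of the symbol m as group law. *)
Definition elementary_group L (m : funsym L 2) (C : groupType) (D : set C)
    (M : structure L D) T' (M' : structure L T') (j : D -> T')
    (hD : subgroup D)
    (hM : forall x y : D, set_val (binop M m x y) = set_val x * set_val y)
    (hj : elementary M M' j) : groupType :=
  group_of (elementary_is_group hj (subgroup_is_group hD hM)).

(* The closed sets of the logic topology on G / N; small means < |K|. *)
Definition logic_closed (K : Type) L (G : groupType) (M : structure L G)
    (N : normalSubgroup G) (F : set (quotient N)) : Prop :=
  exists2 B : set G, card_lt K B & type_definable_over M B (coset N @^-1` F).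

(* f is a homeomorphism from X, with the topology whose closed sets are
   [closedX], to Y. *)
Definition homeomorphism_from X (closedX : set (set X)) (Y : topologicalType)
    (f : X -> Y) : Prop :=
  [/\ bijective f,
      (forall F : set Y, closed F -> closedX (f @^-1` F)) &
      (forall F : set X, closedX F -> closed (f @` F))].

(* Main.v *)
Require Import Defs.
From HB Require Import structures.
From mathcomp Require Import all_boot.
From mathcomp Require Import boolp classical_sets functions cardinality.
From mathcomp Require Import topology.

Set Implicit Arguments.
Unset Strict Implicit.
Unset Printing Implicit Defensive.

Import Algebra.

Local Open Scope classical_set_scope.
Local Open Scope group_scope.

(** Every point of C has a basis of neighbourhoods a U_i with a in D, and the
    traces a U_i' of these on D are definable.  Hence, for x in D^*, the
    definable sets S of D with x in S^* generate a filter on C that contains,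
    for every such neighbourhood V, the trace of V or its complement; by
    compactness it converges, and st(x) is its limit.  Since S^* R^* = (S R)^*,
    continuity of the product makes st a homomorphism.  All of surjectivity,
    st(S^* ) = closure of S and closedness of st come from one saturation
    argument: if c is a limit of standard parts of points of a type-definable
    set X, then the type of X together with the interpretations of the
    definable neighbourhoods of c is finitely satisfiable.  Its set of
    parameters is B u D with B small; this is again small because |K| exceeds
    2^|D|, so that a subset of K of size at most |D| can be absorbed into its
    complement. *)

(** * Cardinalities *)

Lemma card_leE {T U : Type} (A : set T) (B : set U) :
  card_le A B <-> exists f : A -> B, injective f.
Proof.
split=> [/card_leP[f]|[f fI]].
  by exists f => x y; apply: inj; rewrite inE.
by apply/card_leP/injfunPex; exists f => // x y _ _; exact: fI.
Qed.

Lemma card_leTr {T K : Type} (A : set T) :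
  card_le A [set: K] <-> exists f : A -> K, injective f.
Proof.
rewrite card_leE; split=> [[f fI]|[f fI]].
  by exists (val \o f) => x y /val_inj/fI.
by exists (to_setT \o f) => x y /(congr1 val)/fI.
Qed.

Lemma card_leTl {T K : Type} (A : set T) :
  card_le [set: K] A <-> exists f : K -> A, injective f.
Proof.
rewrite card_leE; split=> [[f fI]|[f fI]].
  by exists (f \o to_setT) => x y /fI/(congr1 val).
by exists (f \o val) => x y /fI/val_inj.
Qed.

Lemma cantor_no_inj (E : Type) (f : set E -> E) : ~ injective f.
Proof.
move=> fI; pose R := [set x | exists2 s, x = f s & ~ s x].
have [Rf|nRf] := pselect (R (f R)).
  by have [s /fI Rs ns] := Rf; apply: ns; rewrite -Rs.
by apply: (nRf); exists R.
Qed.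

(* Hilbert's hotel: each copy of [nat] inside [X] is shifted to make room. *)
Lemma inj_sum_absorb (X E : Type) (h : E * nat -> X) : injective h ->
  exists g : X + E -> X, injective g.
Proof.
move=> hI.
have P x : exists y, (forall e n, x = h (e, n) -> y = h (e, n.+1)) /\
                     ((forall en, x <> h en) -> y = x).
  have [[[e n] ->]|nh] := pselect (exists en, x = h en).
    exists (h (e, n.+1)); split=> [e' n' /hI[-> ->//]|/(_ (e, n))//].
  by exists x; split=> // e n xE; case: nh; exists (e, n).
have [s sP] := choice P.
have sh e n : s (h (e, n)) = h (e, n.+1) by exact: (sP _).1.
have sn x : (forall en, x <> h en) -> s x = x by exact: (sP _).2.
have hP x : (exists en, x = h en) \/ forall en, x <> h en.
  have [|nh] := pselect (exists en, x = h en); [by left|right=> en xE].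
  by apply: nh; exists en.
exists (fun z => match z with inl x => s x | inr e => h (e, 0) end).
move=> [x|e] [y|e'].
- have [[[e n] ->]|nx] := hP x; have [[[e' n'] ->]|ny] := hP y;
    rewrite ?sh ?(sn _ nx) ?(sn _ ny).
  + by move=> /hI[-> ->].
  + by move=> /esym/ny.
  + by move=> /nx.
  + by move->.
- have [[[e n] ->]|nx] := hP x; rewrite ?sh ?(sn _ nx).
  + by move=> /hI[].
  + by move=> /nx.
- have [[[e' n] ->]|ny] := hP y; rewrite ?sh ?(sn _ ny).
  + by move=> /hI[].
  + by move=> /esym/ny.
- by move=> /hI[->].
Qed.

Lemma card_lt_le {K T U : Type} (A : set T) (B : set U) :
  card_le A B -> card_lt K B -> card_lt K A.
Proof.
move=> AB [BK nKB]; split; first exact: card_le_trans BK.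
by move=> KA; apply: nKB; exact: card_le_trans AB.
Qed.

(* A set [s] of elements of [E] such that the slice [h (s, _)] avoids the part
   of [K] mapped to [B] exists by Cantor's theorem; that slice leaves room for
   moving the part mapped to [B] into the part mapped to [A]. *)
Lemma card_lt_setU {K T E : Type} (A B : set T)
    (h : set E * (E * nat) -> K) : injective h ->
  card_le B [set: E] -> card_lt K A -> card_lt K (A `|` B).
Proof.
move=> hI /card_leTr[u uI] [/card_leTr[a aI] nKA].
have toA x : A x -> exists y : A, val y = x.
  by move=> Ax; exists (SigSub (mem_set Ax)).
have toB x : B x -> exists y : B, val y = x.
  by move=> Bx; exists (SigSub (mem_set Bx)).
split.
  apply/card_leTr.
  (* Any slice of [h] serves as a copy of [E * nat] in [K]; [set0] merely picks one. *)
  have [|g gI] := @inj_sum_absorb K E (fun en => h (set0, en)).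
    by move=> x y /hI[].
  have P (x : (A `|` B : set T)) : exists z : K + E,
      (exists2 y : A, val y = val x & z = inl (a y)) \/
      (exists2 y : B, val y = val x & z = inr (u y)).
    have [/toA[y yE]|/toB[y yE]] := set_mem (valP x).
      by exists (inl (a y)); left; exists y.
    by exists (inr (u y)); right; exists y.
  have [f fP] := choice P.
  exists (g \o f) => x y /gI fxy; apply: val_inj.
  case: (fP x) (fP y) => [[x' <- fx]|[x' <- fx]] [[y' <- fy]|[y' <- fy]];
    move: fxy; rewrite fx fy => // -[].
    by move/aI->.
  by move/uI->.
move=> /card_leTl[f fI]; apply: nKA.
(* If every slice met the part mapped to [B], one such element of [B] per slice would inject [set E]
   into [E], since [f] and [h] recover the slice. *)
have [s sP] : exists s, forall en, ~ B (val (f (h (s, en)))).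
  apply: contrapT => nex.
  have P s : exists e : E, exists en, exists2 y : B,
      val y = val (f (h (s, en))) & e = u y.
    apply: contrapT => ns; apply: nex; exists s => en /toB[y yE].
    by apply: ns; exists (u y), en, y.
  have [c cP] := choice P.
  apply: (@cantor_no_inj E c) => s t st.
  have [en [y yE cs]] := cP s; have [en' [y' yE' ct]] := cP t.
  move: st; rewrite cs ct => /uI yy'; move: yE; rewrite yy' yE' => /val_inj.
  by move=> /fI/hI[].
pose X := {k : K | ~ B (val (f k))}.
have XI (x y : X) : sval x = sval y -> x = y.
  case: x y => x px [y py] /= xy; subst y.
  by congr exist; exact: Prop_irrelevance.
pose hX en : X := exist _ (h (s, en)) (sP en).
have [|g gI] := @inj_sum_absorb X E hX; first by move=> x y /(congr1 sval)/hI[].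
have P k : exists z : X + E,
    (exists2 x : X, sval x = k & z = inl x) \/
    (exists2 y : B, val y = val (f k) & z = inr (u y)).
  have [/toB[y yE]|nB] := pselect (B (val (f k))).
    by exists (inr (u y)); right; exists y.
  by exists (inl (exist _ k nB)); left; exists (exist _ k nB).
have [r rP] := choice P.
have Q (x : X) : exists y : A, val y = val (f (sval x)).
  by apply: toA; case: (set_mem (valP (f (sval x)))) => // /(svalP x).
have [q qP] := choice Q.
apply/card_leTl; exists (q \o g \o r) => k k' /(congr1 val).
rewrite !qP => /val_inj/fI/XI/gI.
case: (rP k) (rP k') => [[x <- ->]|[x xE ->]] [[y <- ->]|[y yE ->]] // [].
  by move->.
by move/uI => xy; move: xE; rewrite xy yE => /val_inj/fI.
Qed.

(** * Formulas with parameters *)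

Section Formulas.
Variables (L : language) (m : funsym L 2).
Implicit Types T : Type.

Definition pf_neg {T} (p : pformula L T) : pformula L T :=
  PFormula (Imp (pf_form p) (Bot L _)) (pf_param p).

Definition pf_bot {T} : pformula L T :=
  @PFormula L T 0 (Bot L _) (fun i => False_rect _ (notF (ltn_ord i))).

Definition pf_eq {T} (a : T) : pformula L T :=
  @PFormula L T 1 (Eq (Var L ord0) (Var L (lift ord0 ord0))) (fun=> a).

Definition vcat {T n k} (v : 'I_n -> T) (w : 'I_k -> T) : 'I_(n + k) -> T :=
  fun i => match fintype.split i with inl a => v a | inr b => w b end.

Definition pf_imp {T} (p q : pformula L T) : pformula L T :=
  PFormula (Imp (fren (pf_form p) (upren (@lshift _ (pf_arity q))))
                (fren (pf_form q) (upren (@rshift (pf_arity p) _))))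
           (vcat (pf_param p) (pf_param q)).

Definition pf_and {T} (p q : pformula L T) : pformula L T :=
  pf_neg (pf_imp p (pf_neg q)).

Definition lift3 {n} (i : 'I_n) : 'I_n.+3 :=
  lift ord0 (lift ord0 (lift ord0 i)).

(* exists y z, x = y z /\ p(y) /\ q(z), where z, y, x are the variables
   0, 1, 2. *)
Definition pf_mul {T} (p q : pformula L T) : pformula L T :=
  PFormula
    (Imp (All (All (Imp
       (Eq (Var L (lift ord0 (lift ord0 ord0)))
           (App m (pair_fun (Var L (lift ord0 ord0)) (Var L ord0))))
       (Imp (fren (pf_form p) (vcons (lift ord0 ord0)
               (fun i => lift3 (lshift (pf_arity q) i))))
       (Imp (fren (pf_form q) (vcons ord0
               (fun i => lift3 (rshift (pf_arity p) i))))
            (Bot L _)))))) (Bot L _))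
    (vcat (pf_param p) (pf_param q)).

Lemma vcat_lshift {T n k} (v : 'I_n -> T) (w : 'I_k -> T) :
  vcat v w \o @lshift n k = v.
Proof.
by apply/funext => i; rewrite /= /vcat -[lshift k i]/(unsplit (inl i)) unsplitK.
Qed.

Lemma vcat_rshift {T n k} (v : 'I_n -> T) (w : 'I_k -> T) :
  vcat v w \o @rshift n k = w.
Proof.
by apply/funext => i; rewrite /= /vcat -[rshift n i]/(unsplit (inr i)) unsplitK.
Qed.

Section Semantics.
Variables (T : Type) (M : structure L T).
Implicit Types p q : pformula L T.

Lemma pf_negE p : pf_set M (pf_neg p) = ~` pf_set M p.
Proof. by []. Qed.

Lemma pf_eqE a : pf_set M (pf_eq a) = [set a].
Proof.
by apply/seteqP; split=> x; rewrite /pf_set /= vcons0 vconsS.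
Qed.

Lemma pf_impE p q :
  pf_set M (pf_imp p q) = [set x | pf_set M p x -> pf_set M q x].
Proof.
apply/funext => x; rewrite /pf_set /= !(propext (sat_fren _ _ _ _)).
by rewrite !vcons_upren vcat_lshift vcat_rshift.
Qed.

Lemma pf_andE p q : pf_set M (pf_and p q) = pf_set M p `&` pf_set M q.
Proof.
rewrite /pf_and pf_negE pf_impE pf_negE.
apply/seteqP; split=> [x /= npq|x [px qx] /=]; last exact.
by apply: contrapT => pq; apply: npq => px qx; apply: pq.
Qed.

Lemma pf_mulE p q : pf_set M (pf_mul p q) =
  [set x | exists y z, [/\ pf_set M p y, pf_set M q z & x = binop M m y z]].
Proof.
have E x y z : (sat M (fren (pf_form p) (vcons (lift ord0 ord0)
    (fun i => lift3 (lshift (pf_arity q) i))))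
    (vcons z (vcons y (vcons x (vcat (pf_param p) (pf_param q))))) =
    pf_set M p y) /\
  (sat M (fren (pf_form q) (vcons ord0
    (fun i => lift3 (rshift (pf_arity p) i))))
    (vcons z (vcons y (vcons x (vcat (pf_param p) (pf_param q))))) =
    pf_set M q z).
  rewrite !(propext (sat_fren _ _ _ _)) !vcons_comp !vconsS !vcons0.
  split; congr (sat _ _ (vcons _ _)); apply/funext => i /=;
    rewrite /lift3 !vconsS.
    by rewrite -[in RHS](vcat_lshift (pf_param p) (pf_param q)).
  by rewrite -[in RHS](vcat_rshift (pf_param p) (pf_param q)).
have F x y z : (Defs.eval M (vcons z (vcons y (vcons x
     (vcat (pf_param p) (pf_param q)))))
     (App m (pair_fun (Var L (lift ord0 ord0)) (Var L ord0)))) = binop M m y z.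
  rewrite /= /binop; congr finterp; apply/funext => i; rewrite /pair_fun.
  by case: ifP => _ /=; rewrite ?vconsS vcons0.
(* The existential is encoded as a negated universal, hence the doubly negated form; classical logic
   removes it at the end. *)
have G x : pf_set M (pf_mul p q) x = ((forall y z,
    x = binop M m y z -> pf_set M p y -> pf_set M q z -> False) -> False).
  have -> : (forall y z, x = binop M m y z ->
      pf_set M p y -> pf_set M q z -> False) =
    sat M (All (All (Imp
       (Eq (Var L (lift ord0 (lift ord0 ord0)))
           (App m (pair_fun (Var L (lift ord0 ord0)) (Var L ord0))))
       (Imp (fren (pf_form p) (vcons (lift ord0 ord0)
               (fun i => lift3 (lshift (pf_arity q) i))))
       (Imp (fren (pf_form q) (vcons ord0
               (fun i => lift3 (rshift (pf_arity p) i))))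
            (Bot L _))))))
      (vcons x (vcat (pf_param p) (pf_param q))); last by [].
  rewrite sat_All; apply: eq_forall => y; rewrite sat_All.
  apply: eq_forall => z; rewrite !sat_Imp (E x y z).1 (E x y z).2 -(F x y z).
  by rewrite /= !vconsS vcons0.
apply/seteqP; split=> [x|x [y [z [py qz xE]]]]; last first.
  by rewrite G => /(_ y z); exact.
rewrite G; apply: contraPP => nex; apply => y z xE py qz.
by apply: nex; exists y, z.
Qed.

End Semantics.

Section Map.
Variables (T T' : Type) (f : T -> T').
Implicit Types p q : pformula L T.

Lemma vcat_comp n k (v : 'I_n -> T) (w : 'I_k -> T) :
  f \o vcat v w = vcat (f \o v) (f \o w).
Proof. by apply/funext => i /=; rewrite /vcat; case: fintype.split. Qed.

Lemma pf_map_and p q : pf_map f (pf_and p q) = pf_and (pf_map f p) (pf_map f q).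
Proof. by rewrite /pf_map /pf_and /pf_neg /pf_imp /= vcat_comp. Qed.

Lemma pf_map_mul p q : pf_map f (pf_mul p q) = pf_mul (pf_map f p) (pf_map f q).
Proof. by rewrite /pf_map /pf_mul /= vcat_comp. Qed.

End Map.
End Formulas.

Arguments pf_bot {L T}.

(** The arity encodes [n] and the constant parameter encodes [e]; the arity is [n.+1] so that the
    range of parameters is nonempty and [e] can be read off. *)
Lemma inj_pformula L (T : Type) :
  exists u : T * nat -> pformula L T, injective u.
Proof.
exists (fun en => @PFormula L T en.2.+1 (Bot L _) (fun=> en.1)).
move=> [e n] [e' n'] /= E.
have [nn'] := congr1 (@pf_arity _ _) E.
have := congr1 (fun p => range (pf_param p)) E => /= R.
have : range (fun _ : 'I_n'.+1 => e') e by rewrite -R; exists ord0.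
by case=> _ _ ->; rewrite nn'.
Qed.

(** The set is coded at index 0 and the pair at a positive index, so the two parts do not mix. This
    supplies the embedding into [K] on which [card_lt_setU] rests. *)
Lemma inj_set_pformula L (T : Type) :
  exists h : set T * (T * nat) -> set (pformula L T), injective h.
Proof.
have [u uI] := inj_pformula L T.
exists (fun z => [set u (e, 0) | e in z.1] `|` [set u (z.2.1, z.2.2.+1)]).
move=> [s [e n]] [s' [e' n']] /= E.
have -> : s = s'.
  apply/seteqP; split=> x sx;
    have : ([set u (x0, 0) | x0 in s] `|` [set u (e, n.+1)]) (u (x, 0)).
  - by left; exists x.
  - by rewrite E => -[[y sy /uI[<-]]|/uI//].
  - by rewrite E; left; exists x.
  - by move=> [[y sy /uI[<-]]|/uI//].
have : (([set u (x0, 0) | x0 in s'] `|` [set u (e', n'.+1)]) (u (e,n.+1))).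
  by rewrite -E; right.
by move=> [[y _ /uI//]|/uI[-> ->]].
Qed.

(** * Standard parts *)

Lemma filter_finite_bigcap {X J : Type} (F : set_system X) (Q : set J)
    (f : J -> set X) : Filter F -> finite_set Q ->
  (forall i, Q i -> F (f i)) -> F (\bigcap_(i in Q) f i).
Proof.
(* Equips [J] with the classical choice structure that [finite_fsetP] works with. *)
move=> FF; elim/Pchoice: J => J in Q f *.
by move=> /finite_fsetP[Z ->] FQ; exact: filter_bigI.
Qed.

Section StandardPart.
Variables (C : topologicalType) (D : set C) (L : language).
Variables (M : structure L D) (T : Type) (N : structure L T) (j : D -> T).
Hypothesis hj : elementary M N j.
Implicit Types (p q : pformula L D) (c : C) (x y : T).

Let trace p : set C := set_val @` pf_set M p.
Let inst p : set T := pf_set N (pf_map j p).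

(** The trace of [p] is a relative neighbourhood of [c] in [D]; points outside [D] satisfy the
    condition vacuously, so [c] may lie outside [D]. *)
Definition around p c : Prop :=
  nbhs c [set y | forall d : D, set_val d = y -> pf_set M p d].

(* The definable sets whose interpretation contains [x] converge to [c]. *)
Definition stands x c : Prop :=
  forall W, nbhs c W -> exists2 p, inst p x & trace p `<=` W.

Lemma inst_elementary p d : inst p (j d) <-> pf_set M p d.
Proof. by rewrite /inst /pf_set /= -vcons_comp; split=> /hj. Qed.

Lemma inst_sub {p q} : pf_set M p `<=` pf_set M q -> inst p `<=` inst q.
Proof. exact: star_sub. Qed.

Lemma inst_and p q x : inst p x -> inst q x -> inst (pf_and p q) x.
Proof. by rewrite /inst pf_map_and pf_andE. Qed.

(** Otherwise [p] would imply [pf_bot] in [M], hence also in [N]. *)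
Lemma inst_nonempty {p x} : inst p x -> exists d, pf_set M p d.
Proof.
move=> px; apply: contrapT => np.
have : pf_set M p `<=` pf_set M pf_bot by move=> d pd; case: np; exists d.
by move=> /inst_sub/(_ x px).
Qed.

(** Near [c] all points of [D] satisfy [p], so a [q] with trace in that neighbourhood implies [p],
    and elementarity carries the implication to [N]. *)
Lemma stands_around {x c p} : stands x c -> around p c -> inst p x.
Proof.
move=> xc /xc[q qx qp]; apply: inst_sub qx => d qd.
by apply: (qp (set_val d)) => //; exists d.
Qed.

Lemma stands_closure {x c p} : stands x c -> inst p x -> closure (trace p) c.
Proof.
move=> xc px W /xc[q qx qW].
have [d] := inst_nonempty (inst_and px qx); rewrite pf_andE => -[pd qd].
by exists (set_val d); split; [exists d|apply: qW; exists d].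
Qed.

Lemma stands_unique {x c c'} :
  hausdorff_space C -> stands x c -> stands x c' -> c = c'.
Proof.
move=> hC xc xc'; apply: hC => V W /xc[p px pV] /xc'[q qx qW].
have [d] := inst_nonempty (inst_and px qx); rewrite pf_andE => -[pd qd].
by exists (set_val d); split; [apply: pV|apply: qW]; exists d.
Qed.

Hypothesis D_dense : dense D.
Hypothesis around_basis : forall c W, nbhs c W ->
  exists2 p, around p c & trace p `<=` W.

(** Converse of [stands_around]: definable neighbourhoods form a basis, so they suffice to test
    convergence. *)
Lemma standsP x c : (forall p, around p c -> inst p x) -> stands x c.
Proof. by move=> h W /around_basis[p /h px pW]; exists p. Qed.

Lemma stands_elementary d : stands (j d) (set_val d).
Proof. by apply: standsP => p /nbhs_singleton h; exact/inst_elementary/h. Qed.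

Lemma stands_exists x : compact [set: C] -> exists c, stands x c.
Proof.
move=> cC.
pose F : set_system C := [set W | exists2 p, inst p x & trace p `<=` W].
have FF : ProperFilter F.
  split; last split.
  - by move=> [p /inst_nonempty[d pd] p0]; apply: (p0 (set_val d)); exists d.
  - by exists (pf_neg pf_bot).
  - move=> V W [p px pV] [q qx qW]; exists (pf_and p q); first exact: inst_and.
    move=> _ [d + <-]; rewrite pf_andE => -[pd qd].
    by split; [apply: pV|apply: qW]; exists d.
  - by move=> V W VW [p px pV]; exists p => //; exact: subset_trans VW.
have [c [_ Fc]] := cC F FF filterT.
exists c; apply: standsP => p pc; apply: contrapT => npx.
(* The cluster point is a limit: otherwise the complement of [p] is in the filter, so its trace
   meets the neighbourhood of [c] where [D] lies in [p]. *)
have /Fc/(_ pc)[_ [[d nd <-] /(_ d erefl)//]] : F (trace (pf_neg p)).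
by exists (pf_neg p).
Qed.

(** Codes points of [C] by sets of formulas, which will bound the index of the kernel. Density puts
    a point of [D] in any neighbourhood of [c'] on which [p] holds. *)
Lemma around_inj c c' :
  hausdorff_space C -> (forall p, around p c -> around p c') -> c = c'.
Proof.
move=> hC cc'; apply: hC => V W /around_basis[p /cc' pc' pV] Wc'.
have := @filterI _ (nbhs c') (nbhs_filter c') _ _ pc' Wc'.
rewrite nbhsE => -[O [Oo Oc'] OpW].
have [y [/OpW[yp yW] Dy]] := D_dense (ex_intro _ c' Oc') Oo.
pose d : D := SigSub (mem_set Dy).
by exists y; split=> //; apply: pV; exists d => //; exact: yp.
Qed.

(** [pf_mul] describes the product of two definable neighbourhoods both in [M] and in [N]. *)
Lemma stands_mul (m : funsym L 2) (mul : C * C -> C) x y c c' :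
    (forall d e, set_val (binop M m d e) = mul (set_val d, set_val e)) ->
    {for (c, c'), continuous mul} ->
  stands x c -> stands y c' -> stands (binop N m x y) (mul (c, c')).
Proof.
move=> mulE mulC xc yc' W /mulC[[V V'] /= [/xc[p px pV] /yc'[q qy qV']] VW].
exists (pf_mul m p q).
  by rewrite /inst pf_map_mul pf_mulE; exists x, y.
move=> _ [d + <-]; rewrite pf_mulE => -[e [e' [pe qe' ->]]].
rewrite mulE; apply: (VW (_, _)).
by split; [apply: pV; exists e|apply: qV'; exists e'].
Qed.

(** Makes preimages of closed sets type-definable over [D]. For [c] outside [F], regularity gives a
    neighbourhood [V] of [c] with closure off [F]; a formula around [c] with trace in [V] holds at
    [x], while its negation is around every point of [F]. *)
Lemma stands_closed (F : set C) x c :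
    compact [set: C] -> hausdorff_space C -> closed F -> stands x c ->
  F c <-> forall p, (forall c', F c' -> around p c') -> inst p x.
Proof.
move=> cC hC Fcl xc; split=> [Fc p /(_ c Fc)|h]; first exact: stands_around.
apply: contrapT => nFc.
have nb : nbhs c (~` F).
  by apply: open_nbhs_nbhs; split=> //; exact: closed_openC.
have [V cV VF] := @compact_regular C c setT hC cC filterT _ nb.
have [p pc pV] := around_basis cV.
have px : inst p x by exact: stands_around pc.
suff npx : inst (pf_neg p) x by exact: npx px.
apply: h => c' Fc'.
have : ~ closure (trace p) c' by move=> /(closureS pV)/VF.
apply: contra_notP => nb' W Wc'; apply: contrapT => npW; apply: nb'.
apply: filterS Wc' => y Wy d dy pd; apply: npW; exists y; split=> //.
by exists d.
Qed.

Variable K : Type.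
Hypothesis K_big : card_lt K [set: set (pformula L D)].

Lemma card_lt_setU_range (B : set T) :
  card_lt K B -> card_lt K (B `|` range j).
Proof.
have [h hI] := inj_set_pformula L D.
have /card_leTr[k kI] := K_big.1.
apply: (@card_lt_setU _ _ D _ _ (k \o to_setT \o h)).
  by move=> u v /kI/(congr1 val)/hI.
exact: card_image_le.
Qed.

Lemma card_lt_range : card_lt K (range j).
Proof.
apply: card_lt_le K_big; apply: card_le_trans (card_image_le _ _) _.
have [h hI] := inj_set_pformula L D; apply/card_leTr.
exists (fun d => h (set0, (val d, 0))) => d e /hI[]; exact: val_inj.
Qed.

Hypothesis N_sat : saturated K N.

Lemma stands_realized (B : set T) (P : set (pformula L T)) c :
    card_lt K B -> P `<=` Defs.over B ->
    (forall W, nbhs c W -> exists x c', [/\ W c', stands x c' &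
       forall r, P r -> pf_set N r x]) ->
  exists2 x, stands x c & forall r, P r -> pf_set N r x.
Proof.
move=> Bsmall PB Pc.
pose P' := P `|` [set pf_map j p | p in around^~ c].
have [p [/PB pB i|[q _ <-] i]|Q Qfin QP'|x xP'] :=
    @N_sat _ P' (card_lt_setU_range Bsmall).
- by left; exact: pB.
- by right; exists (pf_param q i).
(* Being around a point is an open condition, so each formula of [Q] outside [P] holds at everything
   standing near [c]. On the intersection of these finitely many neighbourhoods the hypothesis gives
   one [x] for all of [Q]. *)
- have [|x [c' [c'Q xc' xP]]] := Pc (\bigcap_(p in Q)
      [set c' | forall x, stands x c' -> P p \/ pf_set N p x]).
    apply: filter_finite_bigcap => // p /QP'[Pp|[q /nbhs_interior qc <-]].
      by apply: filterS filterT => c' _ x _; left.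
    by apply: filterS qc => c' qc' x xc'; right; exact: (stands_around xc').
  by exists x => p Qp; case: (c'Q p Qp x xc') => //; exact: xP.
exists x; first by apply: standsP => p pc; apply: xP'; right; exists p.
by move=> p Pp; apply: xP'; left.
Qed.

(** Points of [D] in [p] stand at themselves, so those near [c] approximate the required [x]. *)
Lemma stands_realized_closure p c :
  closure (trace p) c -> exists2 x, stands x c & inst p x.
Proof.
move=> pc; have [|W Wc|x xc xp] :=
  @stands_realized (range j) [set pf_map j p] c card_lt_range.
- by move=> _ -> i; exists (pf_param p i).
- have [_ [[d pd <-] Wd]] := pc W Wc; exists (j d), (set_val d); split=> //.
    exact: stands_elementary.
  by move=> _ ->; exact/inst_elementary.
by exists x => //; exact: xp.
Qed.

End StandardPart.

(** * Definable neighbourhoods by translation *)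

Lemma mulg_continuousr (C : topologicalGroupType) (a : C) :
  continuous (fun y => a * y).
Proof.
move=> c W /(@mulg_continuous C (a, c))[[V V'] /= [Va V'c] VW].
apply: filterS V'c => y V'y; apply: (VW (a, y)).
by split=> //; exact: nbhs_singleton.
Qed.

Lemma mulVg_continuousl (C : topologicalGroupType) (c : C) :
  continuous (fun a => a^-1 * c).
Proof.
move=> a W /(@mulg_continuous C (a^-1, c))[[V V'] /= [Va V'c] VW].
have Va' : nbhs a [set b | V b^-1] := @invg_continuous C a _ Va.
apply: filterS Va' => b Vb; apply: (VW (b^-1, c)).
by split=> //; exact: nbhs_singleton.
Qed.

Lemma definable_translate_basis (C : topologicalGroupType) (D : set C)
    (I : Type) (U : I -> set C) (L : language) (m : funsym L 2)
    (M : structure L D) :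
    subgroup D -> dense D -> basis_at (1 : C) U ->
    (forall x y : D, set_val (binop M m x y) = set_val x * set_val y) ->
    (forall i, definable M (set_val @^-1` U i)) ->
  forall c W, nbhs c W -> exists2 p : pformula L D, around M p c &
    set_val @` pf_set M p `<=` W.
Proof.
move=> [_ DM DV] D_dense [U_open U_sub] M_mul U_def c W.
rewrite -[c in nbhs c _]mulg1.
move=> /(@mulg_continuous C (c, 1))[[V V'] /= [Vc /U_sub[i UV']] VW].
have U1 : nbhs (c^-1 * c) (U i).
  by rewrite mulVg; apply: open_nbhs_nbhs; have [] := U_open i.
have Uc := @mulVg_continuousl C c c _ U1.
(* Density gives [a] in [D] so close to [c] that [a * U i] contains [c] and lies in [V * V'], hence
   in [W]. *)
have := @filterI _ (nbhs c) (nbhs_filter c) _ _ Vc Uc.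
rewrite nbhsE => -[O [Oo Oc] OVU].
have [a [/OVU[Va Uac] Da]] := D_dense _ (ex_intro _ c Oc) Oo.
pose d : D := SigSub (mem_set Da).
have [p _ pE] := U_def i.
exists (pf_mul m (pf_eq L d) p).
  have Uac' : nbhs (a^-1 * c) (U i).
    by apply: open_nbhs_nbhs; split=> //; have [] := U_open i.
  have Uc' : nbhs c [set y | U i (a^-1 * y)] :=
    @mulg_continuousr C a^-1 c _ Uac'.
  apply: filterS Uc' => y Uy e ey.
  have Dz : D (a^-1 * y).
    by apply: DM; [exact: DV|rewrite -ey; exact: set_mem (valP e)].
  rewrite pf_mulE pf_eqE -pE; exists d, (SigSub (mem_set Dz)); split=> //.
  by apply: val_inj; rewrite [RHS]M_mul /= mulgA mulgV mul1g.
move=> _ [e + <-]; rewrite pf_mulE pf_eqE -pE => -[_ [z [-> Uz ->]]].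
by rewrite M_mul; apply: (VW (_, _)); split=> //=; exact: UV'.
Qed.

(** * The quotient by a kernel *)

Lemma coset_kerP (G H : groupType) (f : {multiplicative G -> H}) x y :
  coset (ker f) x = coset (ker f) y <-> f x = f y.
Proof.
split=> [/(congr1 sval) /= xy|].
  have : lcoset_set (kernel f) x x.
    by exists 1; [have [[]] := kernel_normal f|rewrite mulg1].
  by rewrite xy => -[n n1 <-]; rewrite gmulfM n1 mulg1.
have sub u v : f u = f v ->
    lcoset_set (kernel f) u `<=` lcoset_set (kernel f) v.
  move=> uv _ [n n1 <-]; exists (v^-1 * (u * n)); last first.
    by rewrite mulgA mulgV mul1g.
  apply: (mulgI (f v)); rewrite -gmulfM mulgA mulgV mul1g gmulfM.
  by rewrite n1 !mulg1.
by move=> fxy; apply: quotient_inj; apply/seteqP; split; exact: sub.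
Qed.

Lemma quotient_morphism (G H : groupType) (f : {multiplicative G -> H}) :
  exists2 g : {multiplicative quotient (ker f) -> H},
    injective g & forall x, g (coset (ker f) x) = f x.
Proof.
(* The value at a coset is the common value of [f] on its representatives. *)
have P (X : quotient (ker f)) :
    exists c, forall x, X = coset (ker f) x -> c = f x.
  by have [x ->] := coset_surj X; exists (f x) => y /coset_kerP.
have [g gP] := choice P.
have gE x : g (coset (ker f) x) = f x by exact: gP.
have gM : {morph g : X Y / X * Y}.
  move=> X Y; have [x ->] := coset_surj X; have [y ->] := coset_surj Y.
  by rewrite [X in g X]quotient_mulE !gE gmulfM.
pose g' : {multiplicative quotient (ker f) -> H} :=
  HB.pack g (isMultiplicative.Build (quotient (ker f)) H g gM).
exists g' => // X Y.
have [x ->] := coset_surj X; have [y ->] := coset_surj Y.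
by rewrite /= !gE => /coset_kerP.
Qed.

(** * The standard part homomorphism *)

Theorem proposition4p7
  (C : topologicalGroupType)
  (C_compact : compact [set: C])
  (C_hausdorff : hausdorff_space C)
  (D : set C)
  (D_subgroup : subgroup D)
  (D_dense : dense D)
  (I : Type)
  (U : I -> set C)
  (U_basis : basis_at (1 : C) U)
  (U_setI : setI_closed (range U))
  (U_square : forall i, exists j,
     [set x * y | x in closure (U j) & y in closure (U j)] `<=` U i)
  (U_inv : forall i, U i = [set x^-1 | x in U i])
  (U_conj : forall i x, [set x^-1 * u * x | u in U i] = U i)
  (L : language)
  (m : funsym L 2)
  (M : structure L D)
  (M_mul : forall x y : D, set_val (binop M m x y) = set_val x * set_val y)
  (A : set D)
  (U_definable : forall i, definable_over M A (set_val @^-1` U i))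
  (K : Type)
  (T : Type)
  (Mstar : structure L T)
  (j : D -> T)
  (hmonster : monster_model K M Mstar j) :
  let Dstar := elementary_group D_subgroup M_mul (monster_elementary hmonster) in
  exists st : {multiplicative Dstar -> C},
    [/\ set_surj [set: Dstar] [set: C] st,
        [/\ kernel st = \bigcap_i star M Mstar j (set_val @^-1` U i),
            type_definable_over Mstar (j @` A) (kernel st),
            normal_subgroup (kernel st) &
            card_lt K [set: quotient (ker st)]],
        (forall d : D, st (j d) = set_val d) /\
        (forall S : set D, definable M S ->
           st @` star M Mstar j S = closure (set_val @` S)) &
        exists st' : {multiplicative quotient (ker st) -> C},
          (forall x, st' (coset (ker st) x) = st x) /\
          homeomorphism_from
            (@logic_closed K L Dstar Mstar (ker st)) st'].
Proof.
move=> Dstar; have [K_big _ K_sat _] := hmonster.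
have hj := monster_elementary hmonster.
have starp p : star M Mstar j (pf_set M p) = pf_set Mstar (pf_map j p).
  exact: starE.
have basis : forall c W, nbhs c W -> exists2 p : pformula L D, around M p c &
    set_val @` pf_set M p `<=` W.
  apply: (definable_translate_basis D_subgroup D_dense U_basis M_mul) => i.
  by have [p _ ->] := U_definable i; exists p.
have [f fP] := choice (fun x => stands_exists hj basis x C_compact).
have fE x c : stands M Mstar j x c -> f x = c.
  by move=> xc; exact: (stands_unique hj C_hausdorff (fP x) xc).
have fM : {morph (f : Dstar -> C) : x y / x * y}.
  move=> x y; apply: fE.
  apply: (stands_mul (mul := fun z => z.1 * z.2)) => //.
  exact: mulg_continuous.
pose st : {multiplicative Dstar -> C} := HB.pack (f : Dstar -> C)
  (isMultiplicative.Build Dstar C f fM).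
have stE x : st x = f x by [].
have [p_ p_A p_E] : exists2 p_ : I -> pformula L D,
    forall i, Defs.over A (p_ i) &
    forall i, set_val @^-1` U i = pf_set M (p_ i).
  have P i : exists p : pformula L D, Defs.over A p /\
      set_val @^-1` U i = pf_set M p.
    by have [p pA pE] := U_definable i; exists p.
  by have [p_ pP] := choice P; exists p_ => i; have [] := pP i.
(* Each [U i] is a neighbourhood of 1, so its interpretation contains the kernel; conversely, as the
   [U i] form a basis at 1, their formulas witness that [x] stands at 1. *)
have kerE : kernel st = \bigcap_i star M Mstar j (set_val @^-1` U i).
  have [U_open U_sub] := U_basis.
  apply/seteqP; split=> [x /= fx1 i _|x xU].
    rewrite p_E starp; apply: (stands_around hj (fP x)).
    rewrite -stE fx1 /around; apply: filterS (open_nbhs_nbhs (U_open i)).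
    by move=> y Uy d dy; rewrite -p_E /= dy.
  apply: fE => W /U_sub[i UW]; exists (p_ i).
    by rewrite -starp -p_E; exact: xU.
  by move=> _ [d + <-]; rewrite -p_E => /UW.
have st_onto p c : closure (set_val @` pf_set M p) c ->
    exists2 x, f x = c & pf_set Mstar (pf_map j p) x.
  move=> /(stands_realized_closure hj basis K_big K_sat)[x /fE xc px].
  by exists x.
have st_surj c : exists x, f x = c.
  (* [pf_neg pf_bot] defines all of [D], whose closure is [C] by density. *)
  have [|x xc _] := st_onto (pf_neg pf_bot) c; last by exists x.
  move=> W; rewrite nbhsE => -[O [Oo Oc] OW].
  have [a [Oa Da]] := D_dense _ (ex_intro _ c Oc) Oo.
  by exists a; split; [exists (SigSub (mem_set Da))|exact: OW].
have [st' st'I st'E] := quotient_morphism st.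
exists st; split.
- by move=> c _; have [x xc] := st_surj c; exists x.
- split=> //; last first.
  (* A coset is coded by the formulas around its image in [C], so the index is at most the number of
     sets of formulas over [D]. *)
  + apply: card_lt_le K_big; apply/card_leTr.
    exists (fun X => [set p | around M p (st' (val X))]) => X Y XY.
    apply/val_inj/st'I; apply: (around_inj D_dense basis C_hausdorff) => p.
    by move: XY => /(congr1 (@^~ p)) /= ->.
  + exact: kernel_normal.
  exists (range (pf_map j \o p_)).
    by move=> _ [i _ <-] k; exists (pf_param (p_ i) k) => //; exact: p_A.
  rewrite kerE; apply/seteqP; split=> [x xU _ [i _ <-]|x xU i _].
    by rewrite /= -starp -p_E; exact: xU.
  by rewrite p_E starp; apply: xU; exists i.
- split=> [d|S [p _ ->]].
    by apply: fE; exact: stands_elementary hj basis d.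
  rewrite starp; apply/seteqP; split=> [_ [x px <-]|c /st_onto[x <- px]].
    exact: (stands_closure hj (fP x) px).
  by exists x.
exists st'; split; first exact: st'E.
split.
- have P c : exists X, st' X = c.
    by have [x <-] := st_surj c; exists (coset (ker st) x).
  have [h hP] := choice P; exists h => // X; apply: st'I; exact: hP.
- move=> F F_closed; exists (range j); first exact: card_lt_range K_big.
  exists [set pf_map j p | p in [set p | forall c, F c -> around M p c]].
    by move=> _ [p _ <-] i; exists (pf_param p i).
  apply/seteqP; split=> x.
    rewrite /preimage /= st'E.
    move=> /(stands_closed hj basis C_compact C_hausdorff F_closed (fP x)) xF.
    by move=> _ [p pF <-]; exact: xF.
  move=> xF; rewrite /preimage /= st'E.
  apply/(stands_closed hj basis C_compact C_hausdorff F_closed (fP x)) => p pF.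
  by apply: xF; exists p.
- move=> F [B B_small [P PB PE]] c Fc.
  (* Points of the image of [F] near [c] lift to realizations of [P]; saturation gives one standing
     at [c] itself, and its coset is in [F] because [P] defines the preimage of [F]. *)
  have [W Wc|x /fE xc xP] :=
      stands_realized hj basis K_big K_sat B_small PB (c := c).
    have [_ [[X FX <-] WX]] := Fc W Wc; have [x xX] := coset_surj X.
    exists x, (f x); split=> //; first by rewrite -stE -st'E -xX.
    have : (coset (ker st) @^-1` F) x by rewrite /preimage /= -xX.
    by rewrite PE.
  exists (coset (ker st) x); last by rewrite st'E stE.
  have : (\bigcap_(p in P) pf_set Mstar p) x by [].
  by rewrite -PE.
Qed.
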